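(* Let $q$ be a prime power and let $L$ be a line of $\mathrm{PG}(5,q)$ in the $K$-orbit $o_{13,1}$. Then the hyperplane-orbit distribution $OD_4(L)$ is $\left[3,\,\frac{q^2+3q-2}{2},\,\frac{q^2+q-2}{2},\,q^3-q\right]$ if $q$ is odd, and $\left[q+1,\,\frac{q^2}{2}+q,\,\frac{q^2}{2},\,q^3-q\right]$ if $q$ is even.
   Context: A point $(y_0,\dots,y_5)$ of $\mathrm{PG}(5,q)$ is identified with the nonzero symmetric matrix $\begin{bmatrix} y_0&y_1&y_2\\ y_1&y_3&y_4\\ y_2&y_4&y_5\end{bmatrix}$ up to scalar. $K\cong\mathrm{PGL}(3,q)$ acts by $M\mapsto AMA^T$, $A\in\mathrm{GL}(3,q)$. The orbit $o_{13,1}$ is the $K$-orbit of the line $\left\{\begin{bmatrix} 0&x&0\\ x&y&0\\ 0&0&-y\end{bmatrix}:(x,y)\in\mathrm{PG}(1,q)\right\}$. Hyperplanes correspond to conics of $\mathrm{PG}(2,q)$ (nonzero quadratic forms up to scalar): $\sum_{0\le i\le j\le2}a_{ij}X_iX_j$ corresponds to $a_{00}Y_0+a_{01}Y_1+a_{02}Y_2+a_{11}Y_3+a_{12}Y_4+a_{22}Y_5=0$. $\mathcal H_1,\mathcal H_{2,r},\mathcal H_{2,i},\mathcal H_3$ are the sets of hyperplanes corresponding respectively to double lines (scalar multiples of squares of linear forms), pairs of distinct real lines (products of two non-proportional linear forms over $\mathbb F_q$), pairs of conjugate imaginary lines (scalar multiples of products of two non-proportional linear forms conjugate over $\mathbb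 F_{q^2}$), and non-singular conics (those with $4a_{00}a_{11}a_{22}+a_{01}a_{02}a_{12}-a_{00}a_{12}^2-a_{11}a_{02}^2-a_{22}a_{01}^2\ne0$). $OD_4(L)=[h_1,h_{2,r},h_{2,i},h_3]$ lists the numbers of hyperplanes in $\mathcal H_1,\mathcal H_{2,r},\mathcal H_{2,i},\mathcal H_3$ containing $L$. *)

(* Defs.v *)
From HB Require Import structures.
From mathcomp Require Import all_boot all_order all_algebra all_field.
From mathcomp Require Import mpoly.

Set Implicit Arguments.
Unset Strict Implicit.
Unset Printing Implicit Defensive.

Import GRing.Theory.
Local Open Scope ring_scope.

(* PG(5,q) is the projective space of the 6-dimensional space of symmetric    *)
(* 3 x 3 matrices over F, #|F| = q. A projective subspace is represented by   *)
(* the set of all vectors (matrices) of the linear subspace defining it, the  *)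
(* zero matrix included; inclusion of such sets is projective incidence.      *)

Section ProjectiveSpace.
Variable F : finFieldType.

Definition symmx (y0 y1 y2 y3 y4 y5 : F) : 'M[F]_3 :=
  \matrix_(i, j) nth 0 (nth [::] [:: [:: y0; y1; y2];
                                     [:: y1; y3; y4];
                                     [:: y2; y4; y5]] i) j.

Definition Kact (A : 'M[F]_3) (U : {set 'M[F]_3}) : {set 'M[F]_3} :=
  [set A *m M *m A^T | M in U].

Definition Korbit (U : {set 'M[F]_3}) : {set {set 'M[F]_3}} :=
  [set Kact A U | A : 'M[F]_3 & A \in unitmx].

Definition o_13_1 : {set {set 'M[F]_3}} :=
  Korbit [set symmx 0 x 0 y 0 (- y) | x in [set: F], y in [set: F]].

End ProjectiveSpace.

(* A coefficient family (a_ij)_(i <= j) is a 3 x 3 matrix of which only the   *)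
(* entries on and above the diagonal are ever used. Equalities of forms are   *)
(* equalities of polynomials, not of functions (they differ for small q).     *)

Definition linform (R : comNzRingType) (l : 'rV[R]_3) : {mpoly R[3]} :=
  \sum_(i < 3) l 0 i *: 'X_i.

Definition quadform (R : comNzRingType) (a : 'M[R]_3) : {mpoly R[3]} :=
  \sum_(i < 3) \sum_(j < 3 | (i <= j)%N) a i j *: ('X_i * 'X_j).

Definition nonproportional (R : fieldType) (l m : 'rV[R]_3) : bool :=
  \rank (col_mx l m) == 2%N.

Section Hyperplanes.
(* E is a quadratic extension of F through iota: it is used with              *)
(* #|E| = #|F| ^ 2, and then conjugation over F is x |-> x ^+ #|F|.           *)
Variables (F E : finFieldType) (iota : {rmorphism F -> E}).

Definition conj_row (l : 'rV[E]_3) : 'rV[E]_3 :=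
  map_mx (fun x => x ^+ #|F|) l.

Definition double_line (a : 'M[F]_3) : bool :=
  [exists c : F, exists l : 'rV[F]_3,
    [&& c != 0, l != 0 & quadform a == c *: linform l ^+ 2]].

Definition real_line_pair (a : 'M[F]_3) : bool :=
  [exists l : 'rV[F]_3, exists m : 'rV[F]_3,
    nonproportional l m && (quadform a == linform l * linform m)].

Definition imaginary_line_pair (a : 'M[F]_3) : bool :=
  [exists c : E, exists l : 'rV[E]_3,
    [&& c != 0, nonproportional l (conj_row l) &
        map_mpoly iota (quadform a)
          == c *: (linform l * linform (conj_row l))]].

Definition nonsingular_conic (a : 'M[F]_3) : bool :=
  4%:R * a 0 0 * a 1 1 * a 2 2 + a 0 1 * a 0 2 * a 1 2
    - a 0 0 * a 1 2 ^+ 2 - a 1 1 * a 0 2 ^+ 2 - a 2 2 * a 0 1 ^+ 2 != 0.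

(* The points Y of PG(5,q) with \sum_(i <= j) a_ij Y_ij = 0. *)
Definition hyperplane (a : 'M[F]_3) : {set 'M[F]_3} :=
  [set Y : 'M[F]_3 | (Y^T == Y) &&
     (\sum_(i < 3) \sum_(j < 3 | (i <= j)%N) a i j * Y i j == 0)].

Definition H_1 : {set {set 'M[F]_3}} :=
  [set hyperplane a | a : 'M[F]_3 & double_line a].
Definition H_2r : {set {set 'M[F]_3}} :=
  [set hyperplane a | a : 'M[F]_3 & real_line_pair a].
Definition H_2i : {set {set 'M[F]_3}} :=
  [set hyperplane a | a : 'M[F]_3 & imaginary_line_pair a].
Definition H_3 : {set {set 'M[F]_3}} :=
  [set hyperplane a | a : 'M[F]_3 & nonsingular_conic a].

Definition OD4 (L : {set 'M[F]_3}) : seq nat :=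
  [seq #|[set H in Hs | L \subset H]| | Hs : {set {set 'M[F]_3}} <- [:: H_1; H_2r; H_2i; H_3]].

End Hyperplanes.

(* Quadratic extensions of F always exist. *)
Lemma quadratic_extension_exists (F : finFieldType) :
  exists (E : finFieldType) (iota : {rmorphism F -> E}), #|E| = (#|F| ^ 2)%N.
Proof.
pose g (x : F) := x ^+ 2 - x.
have [c cP] : exists c : F, forall x, g x != c.
  have ninj : ~~ injectiveb g.
    apply/injectiveP => gI; have /eqP := oner_neq0 F; apply.
    by apply: gI; rewrite /g expr1n expr0n !subrr.
  have : ~~ [forall c, c \in codom g].
    apply: contra ninj => /forallP sur.
    apply: (leq_size_uniq (enum_uniq F)) => [x _|]; first exact: sur.
    by rewrite size_codom cardE.
  by case/forallPn=> c cN; exists c => x; apply: contra cN => /eqP <-; apply: codom_f.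
pose p : {poly F} := 'X^2 - ('X + c%:P).
have szl : (size ('X + c%:P : {poly F})%R < size ('X^2 : {poly F})%R)%N.
  by rewrite size_polyXn size_XaddC.
have szp : size p = 3 by rewrite /p size_polyDl ?size_polyN // size_polyXn.
have pM : p \is monic.
  by rewrite monicE /p lead_coefDl ?size_polyN // lead_coefXn.
have pI : irreducible_poly p.
  apply: cubic_irreducible; rewrite ?szp // => x.
  rewrite /root /p !hornerE opprD addrA subr_eq0; exact: cP.
pose hI : monic_irreducible_poly p := (pI, pM).
exists {poly %/ p with hI}, (qpolyC p).
by rewrite card_qfpoly szp.
Qed.

(* Main.v *)
Require Import Defs.
From mathcomp Require Import all_boot all_order all_algebra all_solvable all_field.
From mathcomp Require Import mpoly ring zify.

(* All four classes of conics are invariant under linear substitutions, so L  *)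
(* may be taken to be the representative line of o_{13,1}; the hyperplanes    *)
(* through it are the conics a X0^2 + b X0 X2 + c X1 X2 + d (X1^2 + X2^2).    *)
(* Those with d = 0 are classified by inspection. For d = 1, the singular     *)
(* ones are given by a (4 - c^2) = b^2, which has q^2 solutions, and a line   *)
(* pair over F or E factors, up to scalars, as (u X0 + X1 - t X2) (- u X0 +   *)
(* X1 - t^-1 X2), where (t, u) is unique up to the involution (t, u) |->      *)
(* (t^-1, - u). The fixed points of the involution (2 for q odd, q for q      *)
(* even) give the double lines, the other pairs over F give the real line     *)
(* pairs, and the other pairs over E with t^(q+1) = 1 and u^q = - u give the  *)
(* imaginary ones.                                                            *)

Set Implicit Arguments.
Unset Strict Implicit.
Unset Printing Implicit Defensive.

Import GRing.Theory.
Local Open Scope ring_scope.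

(** By [card_hyperplanes_through_Kact] the line may be taken to be [line0], and
    [card_hyperplanes_through_line0] turns the count into one on the PG(3,q) of conics with
    coordinates d, a, b, c.

    Parity enters only through the number f of fixed points of the involution [swap]: f = 2 for q
    odd and f = q for q even ([card_swap_fixed]). For d = 1 over F, the q(q - 1) parameters (t, u)
    with t nonzero give f double lines and (q(q - 1) - f)/2 real line pairs. Over E, the q(q + 1)
    parameters with t^(q+1) = 1 and u^q = - u have the same f fixed points and give (q(q + 1) - f)/2
    imaginary pairs. These counts rest on the uniqueness in [param_eq] and the existence in
    [conic_factor].

    The plane d = 0 adds one double line, 2q real pairs, no imaginary pair, and q^2 - q nonsingular
    conics to the q^3 - q^2 with d = 1. *)

Lemma ord3P (P : 'I_3 -> Prop) : P 0 -> P 1 -> P 2%:R -> forall i, P i.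
Proof.
move=> P0 P1 P2 [[|[|[|i]]] hi] //.
- by rewrite (_ : Ordinal hi = 0) //; apply: val_inj.
- by rewrite (_ : Ordinal hi = 1) //; apply: val_inj.
- by rewrite (_ : Ordinal hi = 2%:R) //; apply: val_inj.
Qed.

Lemma sum_ord3 (V : nmodType) (f : 'I_3 -> V) :
  \sum_(i < 3) f i = f 0 + f 1 + f 2%:R.
Proof.
rewrite !big_ord_recl big_ord0 addr0 addrA.
by congr (f _ + f _ + f _); apply: val_inj.
Qed.

Lemma sum_upper3 (V : nmodType) (f : 'I_3 -> 'I_3 -> V) :
  \sum_(i < 3) \sum_(j < 3 | (i <= j)%N) f i j =
  f 0 0 + f 0 1 + f 0 2%:R + (f 1 1 + f 1 2%:R) + f 2%:R 2%:R.
Proof.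
by under eq_bigr do rewrite big_mkcond sum_ord3; rewrite sum_ord3 /= !add0r.
Qed.

Lemma mnm3_eq (m m' : 'X_{1..3}) :
  (m == m') = [&& m 0 == m' 0, m 1 == m' 1 & m 2%:R == m' 2%:R].
Proof.
apply/eqP/and3P => [->//|[/eqP e0 /eqP e1 /eqP e2]].
by apply/mnmP; apply: ord3P.
Qed.

(** * Quadratic forms through their coefficients: products, substitutions, discriminant *)

Section QuadraticForms.
Variable R : comNzRingType.
Implicit Types (a b : 'M[R]_3) (l m : 'rV[R]_3).

(** The monomials ['X_i * 'X_j] with i <= j are distinct, so the polynomial determines the upper
    entries in every characteristic. *)
Lemma mcoeff_quadform a : forall i j : 'I_3, (i <= j)%N ->
  (quadform a)@_(U_(i) + U_(j)) = a i j.
Proof.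
have E (k k' i j : 'I_3) : (a k k' *: ('X_k * 'X_k') : {mpoly R[3]})@_(U_(i) + U_(j)) =
    a k k' * ((U_(k) + U_(k'))%MM == (U_(i) + U_(j))%MM)%:R.
  by rewrite mcoeffZ -mpolyXD mcoeffX.
apply: ord3P; apply: ord3P => // _;
  by rewrite /quadform sum_upper3 !mcoeffD !E !mnm3_eq !mnmDE !mnm1E /=
     ?(mulr1, mulr0, addr0, add0r).
Qed.

Definition eq_upper a b := forall i j : 'I_3, (i <= j)%N -> a i j = b i j.

Lemma quadform_eqP a b : quadform a = quadform b <-> eq_upper a b.
Proof.
split=> [e i j ij|e]; first by rewrite -!mcoeff_quadform // e.
by apply: eq_bigr => i _; apply: eq_bigr => j ij; rewrite e.
Qed.

Lemma eq_upper3 a b : a 0 0 = b 0 0 -> a 0 1 = b 0 1 -> a 0 2%:R = b 0 2%:R ->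
  a 1 1 = b 1 1 -> a 1 2%:R = b 1 2%:R -> a 2%:R 2%:R = b 2%:R 2%:R ->
  eq_upper a b.
Proof. by move=> *; apply: ord3P; apply: ord3P. Qed.

Lemma eq_upper_sym a b : eq_upper a b -> eq_upper b a.
Proof. by move=> ab i j ij; rewrite ab. Qed.

Lemma eq_upper_trans b a c : eq_upper a b -> eq_upper b c -> eq_upper a c.
Proof. by move=> ab bc i j ij; rewrite ab ?bc. Qed.

Lemma eq_upperZ k a b : eq_upper a b -> eq_upper (k *: a) (k *: b).
Proof. by move=> ab i j ij; rewrite !mxE ab. Qed.

Definition lmul l m : 'M[R]_3 :=
  \matrix_(i, j) if i == j then l 0 i * m 0 i else l 0 i * m 0 j + l 0 j * m 0 i.

Lemma linformM l m : linform l * linform m = quadform (lmul l m).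
Proof.
rewrite /linform /quadform sum_upper3 !sum_ord3 !mxE /= -!mul_mpolyC.
rewrite !mpolyCD !mpolyCM; ring.
Qed.

Lemma quadformD a b : quadform (a + b) = quadform a + quadform b.
Proof.
rewrite /quadform -big_split; apply: eq_bigr => i _.
by rewrite -big_split; apply: eq_bigr => j _; rewrite mxE scalerDl.
Qed.

Lemma quadformZ k a : quadform (k *: a) = k *: quadform a.
Proof.
rewrite /quadform scaler_sumr; apply: eq_bigr => i _.
by rewrite scaler_sumr; apply: eq_bigr => j _; rewrite mxE scalerA.
Qed.

Lemma quadform0 : quadform (0 : 'M[R]_3) = 0.
Proof. by rewrite -(scale0r 0) quadformZ scale0r. Qed.

(** The form obtained by replacing each variable ['X_i] by the linear form of row i of [B], written
    on coefficients so that it can be compared with the action on matrices. *)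
Definition subst_coef a (B : 'M[R]_3) : 'M[R]_3 :=
  \sum_(i < 3) \sum_(j < 3 | (i <= j)%N) a i j *: lmul (row i B) (row j B).

Definition lsubst (B : 'M[R]_3) (p : {mpoly R[3]}) : {mpoly R[3]} :=
  p \mPo [tuple linform (row i B) | i < 3].

Lemma lsubst_linform l B : lsubst B (linform l) = linform (l *m B).
Proof.
rewrite /lsubst /linform raddf_sum /=.
under eq_bigr => i _ do
  rewrite linearZ /= comp_mpolyXU -tnth_nth tnth_mktuple scaler_sumr.
rewrite exchange_big; apply: eq_bigr => j _ /=.
rewrite mxE scaler_suml; apply: eq_bigr => i _.
by rewrite scalerA mxE.
Qed.

Lemma lsubst_quadform a B : lsubst B (quadform a) = quadform (subst_coef a B).
Proof.
have qs (I : finType) (P : pred I) (f : I -> 'M[R]_3) :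
    quadform (\sum_(i | P i) f i) = \sum_(i | P i) quadform (f i).
  exact: (big_morph _ quadformD quadform0).
rewrite /subst_coef qs /lsubst {1}/quadform raddf_sum; apply: eq_bigr => i _.
rewrite qs raddf_sum; apply: eq_bigr => j _ /=.
rewrite quadformZ -linformM linearZ rmorphM /= !comp_mpolyXU.
by rewrite -!tnth_nth !tnth_mktuple.
Qed.

Definition pairing a (Y : 'M[R]_3) : R :=
  \sum_(i < 3) \sum_(j < 3 | (i <= j)%N) a i j * Y i j.

(** This duality turns the action on points into substitution in conics. By linearity it reduces to
    a product of linear forms, whose pairing with a symmetric [Y] is the bilinear value
    [l *m Y *m m^T]. *)
Lemma pairing_subst a B Y : Y^T = Y ->
  pairing (subst_coef a B) Y = pairing a (B *m Y *m B^T).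
Proof.
move=> /matrixP sY.
have l10 := sY 0 1; have l20 := sY 0 2%:R; have l21 := sY 1 2%:R.
rewrite !mxE in l10 l20 l21.
have E l m : pairing (lmul l m) Y = (l *m Y *m m^T) 0 0.
  rewrite /pairing sum_upper3 !mxE !sum_ord3 !mxE !sum_ord3 /= l10 l20 l21; ring.
have pD b c : pairing (b + c) Y = pairing b Y + pairing c Y.
  rewrite /pairing -big_split; apply: eq_bigr => i _.
  by rewrite -big_split; apply: eq_bigr => j _; rewrite mxE mulrDl.
have pZ k b : pairing (k *: b) Y = k * pairing b Y.
  rewrite /pairing mulr_sumr; apply: eq_bigr => i _.
  by rewrite mulr_sumr; apply: eq_bigr => j _; rewrite mxE mulrA.
have p0 : pairing 0 Y = 0 by rewrite -(scale0r 0) pZ mul0r.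
have ps (I : finType) (P : pred I) (f : I -> 'M[R]_3) :
    pairing (\sum_(i | P i) f i) Y = \sum_(i | P i) pairing (f i) Y.
  exact: (big_morph (pairing^~ Y) pD p0).
rewrite /subst_coef ps [RHS]/pairing; apply: eq_bigr => i _.
rewrite ps; apply: eq_bigr => j _.
rewrite pZ E -!row_mul tr_row !mxE; congr (_ * _).
by apply: eq_bigr => k _; rewrite !mxE.
Qed.

Definition disc a : R :=
  4%:R * a 0 0 * a 1 1 * a 2%:R 2%:R + a 0 1 * a 0 2%:R * a 1 2%:R
    - a 0 0 * a 1 2%:R ^+ 2 - a 1 1 * a 0 2%:R ^+ 2 - a 2%:R 2%:R * a 0 1 ^+ 2.

Lemma det3 (B : 'M[R]_3) : \det B =
  B 0 0 * (B 1 1 * B 2%:R 2%:R - B 1 2%:R * B 2%:R 1)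
  - B 0 1 * (B 1 0 * B 2%:R 2%:R - B 1 2%:R * B 2%:R 0)
  + B 0 2%:R * (B 1 0 * B 2%:R 1 - B 1 1 * B 2%:R 0).
Proof.
rewrite (expand_det_row _ 0) sum_ord3 /cofactor.
do 3 rewrite (expand_det_row _ ord0) !big_ord_recl big_ord0 /cofactor !det_mx11.
rewrite !mxE.
(* The expansion leaves different terms for the same ordinal; passing through [inord] of their
   values lets [ring] identify the entries. *)
pose f i j := B (inord i) (inord j).
have fE i j : B i j = f i j by rewrite /f !inord_val.
rewrite !fE /= /bump /= /modn /=.
ring.
Qed.

(** Twice [disc] is the determinant of the Gram matrix of the form, which scales by the squared
    determinant; the halved identity has integer coefficients, so it survives in characteristic
    2. *)
Lemma disc_subst a B : disc (subst_coef a B) = \det B ^+ 2 * disc a.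
Proof.
rewrite det3 /disc /subst_coef sum_upper3 !mxE /=.
ring.
Qed.

End QuadraticForms.

(** Rank 2 is read off the 2 x 2 minors. A nonzero minor kills every left kernel vector by Cramer's
    rule; if all vanish, either l = 0 or m is the multiple of l by m_i / l_i for some nonzero
    l_i. *)
Lemma nonproportionalE (R : fieldType) (l m : 'rV[R]_3) :
  nonproportional l m =
  [|| l 0 0 * m 0 1 != l 0 1 * m 0 0, l 0 0 * m 0 2%:R != l 0 2%:R * m 0 0
    | l 0 1 * m 0 2%:R != l 0 2%:R * m 0 1].
Proof.
apply/idP/idP; last first.
  have free i j : l 0 i * m 0 j != l 0 j * m 0 i -> nonproportional l m.
    rewrite -subr_eq0 => D0.
    rewrite /nonproportional -[_ == _]/(row_free _) -kermx_eq0.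
    apply/rowV0P => v /sub_kermxP.
    rewrite -[v]hsubmxK mul_row_col [lsubmx v]mx11_scalar [rsubmx v]mx11_scalar.
    set x := lsubmx v 0 0; set y := rsubmx v 0 0.
    rewrite !mul_scalar_mx => /rowP e.
    have := e i; have := e j; rewrite !mxE => ej ei.
    have x0 : x = 0.
      apply/(mulIf D0); rewrite mul0r.
      transitivity (m 0 j * (x * l 0 i + y * m 0 i) - m 0 i * (x * l 0 j + y * m 0 j)).
        ring.
      by rewrite ei ej !mulr0 subrr.
    have y0 : y = 0.
      apply/(mulIf D0); rewrite mul0r.
      transitivity (l 0 i * (x * l 0 j + y * m 0 j) - l 0 j * (x * l 0 i + y * m 0 i)).
        ring.
      by rewrite ei ej !mulr0 subrr.
    by rewrite x0 y0 raddf0 row_mx0.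
  by case/or3P; exact: free.
apply: contraTT; rewrite !negb_or !negbK => /and3P[/eqP e01 /eqP e02 /eqP e12].
have e i j : l 0 i * m 0 j = l 0 j * m 0 i.
  by move: i j; apply: ord3P; apply: ord3P.
have le1 (u w : 'rV[R]_3) k : w = k *: u -> (\rank (col_mx u w) <= 1)%N.
  move=> ->; apply: leq_trans (rank_leq_row u); apply: mxrankS.
  by rewrite col_mx_sub submx_refl scalemx_sub.
rewrite /nonproportional neq_ltn ltnS.
have [->|/rV0Pn[i li]] := eqVneq l 0.
  by rewrite -addsmxE (adds0mx 1 m) rank_leq_row.
rewrite (le1 l m (m 0 i / l 0 i)) //; apply/rowP => j; rewrite mxE.
by apply: (mulfI li); rewrite e; field.
Qed.

(** * Linear forms over a field, up to scalars *)

Section LinearForms.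
Variable R : fieldType.
Implicit Types (a b : 'M[R]_3) (l m : 'rV[R]_3).

Lemma linform_eq0 l : linform l = 0 -> l = 0.
Proof.
move=> l0; have /quadform_eqP e : quadform (lmul l l) = quadform 0.
  by rewrite -linformM l0 mulr0 quadform0.
apply/rowP => i; have /eqP := e i i (leqnn _).
by rewrite !mxE eqxx mulf_eq0 orbb => /eqP.
Qed.

Lemma nonproportionalZ k k' l m : k != 0 -> k' != 0 ->
  nonproportional (k *: l) (k' *: m) = nonproportional l m.
Proof.
move=> k0 k'0; rewrite !nonproportionalE !mxE.
have e x y z t : (k * x * (k' * y) == k * z * (k' * t)) = (x * y == z * t).
  rewrite (_ : k * x * _ = k * k' * (x * y)); last by ring.
  rewrite (_ : k * z * _ = k * k' * (z * t)); last by ring.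
  by rewrite (inj_eq (mulfI _)) // mulf_neq0.
by rewrite !e.
Qed.

Lemma nonproportional_mulmx l m (B : 'M[R]_3) : B \in unitmx ->
  nonproportional (l *m B) (m *m B) = nonproportional l m.
Proof.
by move=> uB; rewrite /nonproportional -mul_col_mx mxrankMfree // row_free_unit.
Qed.

Lemma nonproportional_neq0 l m : nonproportional l m -> (l != 0) * (m != 0).
Proof.
rewrite nonproportionalE => h; split; apply: contraTneq h => ->;
  by rewrite !mxE !(mulr0, mul0r) eqxx.
Qed.

Lemma nonproportional_normed l m : l 0 1 = 1 -> m 0 1 = 1 ->
  nonproportional l m = (l != m).
Proof.
move=> l1 m1; rewrite nonproportionalE l1 m1 !mulr1 !mul1r.
apply/idP/idP; first by apply: contraTneq => ->; rewrite !eqxx mulrC eqxx.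
apply: contraNT; rewrite !negb_or !negbK => /and3P[/eqP e0 _ /eqP e2].
by apply/eqP/rowP; apply: ord3P; rewrite ?e0 ?e2 ?l1 ?m1.
Qed.

Lemma quadform_mul_subst a c l m (B : 'M[R]_3) :
  quadform a = c *: (linform l * linform m) ->
  quadform (subst_coef a B) = c *: (linform (l *m B) * linform (m *m B)).
Proof.
rewrite -lsubst_quadform => ->.
by rewrite /lsubst linearZ rmorphM /= -!/(lsubst _ _) !lsubst_linform.
Qed.

Lemma quadform_mul_eqP a c l m :
  quadform a = c *: (linform l * linform m) <-> eq_upper a (c *: lmul l m).
Proof. by rewrite linformM -quadformZ; apply: quadform_eqP. Qed.

Lemma lmul_eq0 c l m : c != 0 -> l != 0 -> m != 0 -> ~ eq_upper (c *: lmul l m) 0.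
Proof.
move=> c0 l0 m0 /quadform_eqP; rewrite quadform0 quadformZ -linformM -mul_mpolyC.
move/eqP; rewrite !mulf_eq0 mpolyC_eq0 (negPf c0) /=.
by case/orP => /eqP/linform_eq0/eqP; rewrite ?(negPf l0) ?(negPf m0).
Qed.

End LinearForms.

(** * Conjugation of E over F, and invariance of the four types of conics *)

Section LineClasses.
Variables (F E : finFieldType) (iota : {rmorphism F -> E}).
Local Notation q := #|F|.

(** q is a power of the characteristic of F, which E shares through [iota]. *)
Lemma exprD_card (x y : E) : (x + y) ^+ q = x ^+ q + y ^+ q.
Proof.
have [p p_pr pF] := finPcharP F.
apply: exprDn_pchar.
rewrite (eq_pnat _ (pcharf_eq (rmorph_pchar iota pF))).
have := pprimeChar_pgroup pF; rewrite /pgroup.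
by rewrite -cardsT.
Qed.

(** The image of [iota] already supplies q roots of X^q - X, which has at most q. *)
Lemma card_fixed_Frobenius (x : E) : x ^+ q = x -> exists y, x = iota y.
Proof.
move=> xq.
have : x \in [set iota y | y in [set: F]].
  suff -> : [set iota y | y in [set: F]] = [set x : E | x ^+ q == x] by rewrite inE xq.
  apply/eqP; rewrite eqEcard; apply/andP; split.
    by apply/subsetP => _ /imsetP[y _ ->]; rewrite inE -rmorphXn /= expf_card.
  rewrite card_imset; last exact: fmorph_inj.
  rewrite cardsT.
  have szp : size ('X^q - 'X : {poly E}) = q.+1.
    by rewrite size_polyDl size_polyXn // size_polyN size_polyX ltnS finNzRing_gt1.
  rewrite -ltnS -szp cardE; apply: max_poly_roots.
  - by rewrite -size_poly_eq0 szp.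
  - by apply/allP => z; rewrite mem_enum inE /root !hornerE subr_eq0.
  - exact: enum_uniq.
by case/imsetP => y _ ->; exists y.
Qed.

(** Matrices over F are fixed by conjugation, so conjugate lines stay conjugate under substitutions
    over F. *)
Lemma conj_row_mulmx (l : 'rV[E]_3) (B : 'M[F]_3) :
  conj_row F (l *m map_mx iota B) = conj_row F l *m map_mx iota B.
Proof.
have q0 : (0 : E) ^+ q = 0 by rewrite expr0n gtn_eqF // ltnW // finNzRing_gt1.
apply/rowP => i; rewrite !mxE (big_morph (fun x : E => x ^+ q) exprD_card q0).
by apply: eq_bigr => j _; rewrite exprMn !mxE -rmorphXn /= expf_card.
Qed.

Lemma map_subst_coef (a B : 'M[F]_3) :
  map_mx iota (subst_coef a B) = subst_coef (map_mx iota a) (map_mx iota B).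
Proof.
rewrite /subst_coef raddf_sum; apply: eq_bigr => i _.
rewrite raddf_sum; apply: eq_bigr => j _; apply/matrixP => k h.
by rewrite /= !mxE rmorphM /=; case: ifP => _; rewrite ?rmorphD !rmorphM.
Qed.

Lemma map_quadform (a : 'M[F]_3) :
  map_mpoly iota (quadform a) = quadform (map_mx iota a).
Proof.
rewrite /quadform raddf_sum; apply: eq_bigr => i _.
rewrite raddf_sum; apply: eq_bigr => j _.
by rewrite /= map_mpolyZ rmorphM /= !map_mpolyX mxE.
Qed.

Lemma map_eq_upper (a b : 'M[F]_3) :
  eq_upper a b -> eq_upper (map_mx iota a) (map_mx iota b).
Proof. by move=> ab i j ij; rewrite !mxE ab. Qed.

Lemma double_lineP (a : 'M[F]_3) : reflect
  (exists c l, [/\ c != 0, l != 0 & eq_upper a (c *: lmul l l)]) (double_line a).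
Proof.
apply: (iffP existsP) => [[c /existsP[l /and3P[? ? /eqP/quadform_mul_eqP]]]|].
  by exists c, l.
case=> c [l [c0 l0 /quadform_mul_eqP /eqP e]].
by exists c; apply/existsP; exists l; rewrite c0 l0.
Qed.

Lemma real_line_pairP (a : 'M[F]_3) : reflect
  (exists l m, nonproportional l m /\ eq_upper a (lmul l m)) (real_line_pair a).
Proof.
apply: (iffP existsP) => [[l /existsP[m /andP[? /eqP e]]]|].
  by exists l, m; split=> //; apply/quadform_eqP; rewrite -linformM.
case=> l [m [lm /quadform_eqP e]].
by exists l; apply/existsP; exists m; rewrite lm e linformM /=.
Qed.

Lemma imaginary_line_pairP (a : 'M[F]_3) : reflect
  (exists c l, [/\ c != 0, nonproportional l (conj_row F l) &
     eq_upper (map_mx iota a) (c *: lmul l (conj_row F l))])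
  (imaginary_line_pair iota a).
Proof.
apply: (iffP existsP) => [[c /existsP[l /and3P[? ? /eqP]]]|].
  by rewrite map_quadform => /quadform_mul_eqP; exists c, l.
case=> c [l [c0 l0 /quadform_mul_eqP /eqP e]].
by exists c; apply/existsP; exists l; rewrite c0 l0 map_quadform.
Qed.

(** What the counting needs from a type of conics. The third condition excludes the zero form, whose
    [hyperplane] would be the whole space; the fourth is invariance under the group. *)
Definition conic_class (P : pred 'M[F]_3) : Prop :=
  [/\ forall a b, eq_upper a b -> P a -> P b,
      forall k a, k != 0 -> P a -> P (k *: a),
      forall a, P a -> ~ eq_upper a 0
    & forall a B, B \in unitmx -> P a -> P (subst_coef a B)].

Lemma double_line_class : conic_class (@double_line F).
Proof.
split=> [a b ab|k a k0|a|a B uB] /double_lineP[c [l [c0 l0 e]]].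
- apply/double_lineP; exists c, l; split=> //.
  exact: eq_upper_trans (eq_upper_sym ab) e.
- apply/double_lineP; exists (k * c), l; split=> //; first exact: mulf_neq0.
  by rewrite -scalerA; apply: eq_upperZ.
- by move=> a0; apply: (lmul_eq0 c0 l0 l0); apply: eq_upper_trans (eq_upper_sym e) a0.
- apply/double_lineP; exists c, (l *m B); split=> //.
    by apply: contraNneq l0 => lB; rewrite -(mulmxK uB l) lB mul0mx.
  by apply/quadform_mul_eqP/quadform_mul_subst/quadform_mul_eqP.
Qed.

Lemma real_line_pair_class : conic_class (@real_line_pair F).
Proof.
split=> [a b ab|k a k0|a|a B uB] /real_line_pairP[l [m [lm e]]].
- apply/real_line_pairP; exists l, m; split=> //.
  exact: eq_upper_trans (eq_upper_sym ab) e.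
- apply/real_line_pairP; exists (k *: l), m; split=> //.
    by rewrite -[m]scale1r nonproportionalZ ?oner_neq0.
  move=> i j ij; rewrite !mxE e // !mxE.
  by case: ifP => _; ring.
- move=> a0; apply: (@lmul_eq0 _ 1 l m); rewrite ?oner_neq0 ?(nonproportional_neq0 lm) //.
  by rewrite scale1r; apply: eq_upper_trans (eq_upper_sym e) a0.
- apply/real_line_pairP; exists (l *m B), (m *m B); split=> //.
    by rewrite nonproportional_mulmx.
  rewrite -[lmul _ _]scale1r; apply/quadform_mul_eqP/quadform_mul_subst/quadform_mul_eqP.
  by rewrite scale1r.
Qed.

Lemma imaginary_line_pair_class : conic_class (imaginary_line_pair iota).
Proof.
split=> [a b ab|k a k0|a|a B uB] /imaginary_line_pairP[c [l [c0 lm e]]].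
- apply/imaginary_line_pairP; exists c, l; split=> //.
  exact: eq_upper_trans (eq_upper_sym (map_eq_upper ab)) e.
- apply/imaginary_line_pairP; exists (iota k * c), l; split=> //.
    by rewrite mulf_neq0 ?fmorph_eq0.
  by rewrite -scalerA map_mxZ; apply: eq_upperZ.
- move=> a0; apply: (lmul_eq0 c0 (nonproportional_neq0 lm).1 (nonproportional_neq0 lm).2).
  apply: eq_upper_trans (eq_upper_sym e) _.
  by have := map_eq_upper a0; rewrite raddf0.
- apply/imaginary_line_pairP; exists c, (l *m map_mx iota B); split=> //.
    by rewrite conj_row_mulmx nonproportional_mulmx ?map_unitmx.
  rewrite conj_row_mulmx map_subst_coef.
  by apply/quadform_mul_eqP/quadform_mul_subst/quadform_mul_eqP.
Qed.

Lemma nonsingular_conic_class : conic_class (@nonsingular_conic F).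
Proof.
have nsE a : nonsingular_conic a = (disc a != 0) by [].
split=> [a b ab|k a k0|a|a B uB]; rewrite !nsE.
- by rewrite /disc !ab.
- rewrite (_ : disc (k *: a) = k ^+ 3 * disc a); last by rewrite /disc !mxE; ring.
  by move=> da; rewrite mulf_neq0 ?expf_neq0.
- by move=> da a0; case/eqP: da; rewrite /disc !a0 // !mxE; ring.
- by move=> da; rewrite disc_subst mulf_neq0 ?expf_neq0 // -unitfE -unitmxE.
Qed.

End LineClasses.

(** * Reduction to [line0] and to normalised equations *)

Section NormalForms.
Variable F : finFieldType.

(** The form d (X1^2 + X2^2) + a X0^2 + b X0 X2 + c X1 X2; by [line0_sub_hyperplane] these are the
    conics whose hyperplanes contain [line0]. *)
Definition conic (d a b c : F) : 'M[F]_3 := symmx a 0 b d c d.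
Definition line0 : {set 'M[F]_3} :=
  [set symmx 0 x 0 y 0 (- y) | x in [set: F], y in [set: F]].

Lemma mem_hyperplane (a Y : 'M[F]_3) :
  (Y \in hyperplane a) = (Y^T == Y) && (pairing a Y == 0).
Proof. by rewrite inE. Qed.

Lemma symmxT y0 y1 y2 y3 y4 y5 :
  (symmx y0 y1 y2 y3 y4 y5 : 'M[F]_3)^T = symmx y0 y1 y2 y3 y4 y5.
Proof.
by apply/matrixP; apply: ord3P; apply: ord3P; rewrite !mxE.
Qed.

Lemma pairing_symmx (a : 'M[F]_3) y0 y1 y2 y3 y4 y5 :
  pairing a (symmx y0 y1 y2 y3 y4 y5) =
  a 0 0 * y0 + a 0 1 * y1 + a 0 2%:R * y2 + (a 1 1 * y3 + a 1 2%:R * y4)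
    + a 2%:R 2%:R * y5.
Proof. by rewrite /pairing sum_upper3 !mxE. Qed.

Lemma line0_sub_hyperplane (a : 'M[F]_3) :
  (line0 \subset hyperplane a) = (a 0 1 == 0) && (a 1 1 == a 2%:R 2%:R).
Proof.
apply/subsetP/andP => [h|[/eqP a01 /eqP a11] _ /imset2P[x y _ _ ->]].
  have h' x y := h _ (imset2_f (fun x y : F => symmx 0 x 0 y 0 (- y))
    (in_setT x) (in_setT y)).
  have := h' 1 0; have := h' 0 1; rewrite !mem_hyperplane !pairing_symmx.
  rewrite !symmxT !eqxx /= !(mulr0, oppr0, mulr1, addr0, add0r) mulrN1.
  by rewrite subr_eq0 => -> ->.
rewrite mem_hyperplane symmxT eqxx pairing_symmx a01 a11 /=; apply/eqP; ring.
Qed.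

Lemma hyperplaneZ k (a : 'M[F]_3) : k != 0 -> hyperplane (k *: a) = hyperplane a.
Proof.
move=> k0; apply/setP => Y; rewrite !mem_hyperplane.
rewrite (_ : pairing (k *: a) Y = k * pairing a Y) ?mulf_eq0 ?(negPf k0) //.
by rewrite /pairing !sum_upper3 !mxE; ring.
Qed.

Lemma eq_upper_hyperplane (a b : 'M[F]_3) : eq_upper a b -> hyperplane a = hyperplane b.
Proof.
move=> ab; apply/setP => Y; rewrite !mem_hyperplane; congr (_ && (_ == _)).
by apply: eq_bigr => i _; apply: eq_bigr => j ij; rewrite ab.
Qed.

(** Points move by [A], so the equation is pulled back along its inverse, and [pairing_subst]
    expresses this on coefficients. *)
Lemma Kact_hyperplane A (a : 'M[F]_3) : A \in unitmx ->
  Kact A (hyperplane a) = hyperplane (subst_coef a (invmx A)).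
Proof.
move=> uA.
have trK n (M : 'M[F]_(n, 3)) : M *m A^T *m (invmx A)^T = M.
  by rewrite -mulmxA -trmx_mul mulVmx // trmx1 mulmx1.
have trK' n (M : 'M[F]_(n, 3)) : M *m (invmx A)^T *m A^T = M.
  by rewrite -mulmxA -trmx_mul mulmxV // trmx1 mulmx1.
apply/setP => Y; rewrite mem_hyperplane; apply/imsetP/andP.
  case=> M; rewrite mem_hyperplane => /andP[/eqP sM pM] ->.
  have sY : (A *m M *m A^T)^T = A *m M *m A^T by rewrite !trmx_mul trmxK sM mulmxA.
  by rewrite pairing_subst // sY eqxx !mulmxA mulVmx // mul1mx trK.
case=> /eqP sY pY; exists (invmx A *m Y *m (invmx A)^T).
  by rewrite mem_hyperplane !trmx_mul trmxK sY -pairing_subst // pY mulmxA eqxx.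
by rewrite !mulmxA mulmxV // mul1mx trK'.
Qed.

Lemma KactK A : A \in unitmx -> cancel (@Kact F A) (Kact (invmx A)).
Proof.
move=> uA U; rewrite /Kact -imset_comp -[RHS]imset_id; apply: eq_imset => M /=.
by rewrite !mulmxA mulVmx // mul1mx -mulmxA -trmx_mul mulVmx // trmx1 mulmx1.
Qed.

(** PG(3,q) cut into affine pieces: the first nonzero coordinate among d, a, b, c is scaled to 1,
    leaving a space, a plane, a line and a point. *)
Definition normal_form : finType := ((F * F * F) + (F * F + (F + unit)))%type.

Definition normal_conic (x : normal_form) : 'M[F]_3 :=
  match x with
  | inl (a, b, c) => conic 1 a b c
  | inr (inl (b, c)) => conic 0 1 b c
  | inr (inr (inl c)) => conic 0 0 1 c
  | inr (inr (inr _)) => conic 0 0 0 1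
  end.

Lemma hyperplane_conic_sub d a b c d' a' b' c' x y z t :
  hyperplane (conic d a b c) = hyperplane (conic d' a' b' c') ->
  a * x + b * y + c * z + d * t = 0 -> a' * x + b' * y + c' * z + d' * t = 0.
Proof.
have memE d1 a1 b1 c1 : (symmx x 0 y t z 0 \in hyperplane (conic d1 a1 b1 c1)) =
    (a1 * x + b1 * y + c1 * z + d1 * t == 0).
  rewrite mem_hyperplane symmxT eqxx pairing_symmx !mxE /=.
  by congr (_ == 0); ring.
by move=> e /eqP h; apply/eqP; rewrite -memE -e memE.
Qed.

(** Evaluating the second equation at points chosen on the first hyperplane shows that the 2 x 2
    minors of the two coefficient vectors vanish; proportional normalised vectors are equal. *)
Lemma hyperplane_normal_inj : injective (fun x => hyperplane (normal_conic x)).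
Proof.
have key (d a b c d' a' b' c' : F) :
    hyperplane (conic d a b c) = hyperplane (conic d' a' b' c') ->
    [/\ d * a' = d' * a, d * b' = d' * b, d * c' = d' * c &
    [/\ a * b' = a' * b, a * c' = a' * c & b * c' = b' * c]].
  move=> e; pose s x y z t := @hyperplane_conic_sub d a b c d' a' b' c' x y z t e.
  split; last split; apply: subr0_eq.
  - by apply: eq_trans (s d 0 0 (- a) _); ring.
  - by apply: eq_trans (s 0 d 0 (- b) _); ring.
  - by apply: eq_trans (s 0 0 d (- c) _); ring.
  - by apply: eq_trans (s (- b) a 0 0 _); ring.
  - by apply: eq_trans (s (- c) 0 a 0 _); ring.
  - by apply: eq_trans (s 0 (- c) b 0 _); ring.
have one0 : (1 : F) = 0 -> False by move/eqP; rewrite oner_eq0.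
move=> [[[a b] c]|[[b c]|[c|[]]]] [[[a' b'] c']|[[b' c']|[c'|[]]]] //= /key;
  rewrite ?(mul1r, mul0r, mulr1) => -[? ? ? [? ? ?]];
  by first [congruence | case: one0 | case: one0; symmetry].
Qed.

Lemma normalize_conic d a b c : ~ eq_upper (conic d a b c) 0 ->
  exists k x, k != 0 /\ conic d a b c = k *: normal_conic x.
Proof.
have cZ k d1 a1 b1 c1 :
    k *: conic d1 a1 b1 c1 = conic (k * d1) (k * a1) (k * b1) (k * c1).
  by apply/matrixP; apply: ord3P; apply: ord3P; rewrite !mxE /= ?mulr0.
move=> nz.
have [d0|d0] := eqVneq d 0; last first.
  exists d, (inl (d^-1 * a, d^-1 * b, d^-1 * c)); split=> //=.
  by rewrite cZ mulr1 !mulVKf.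
have [a0|a0] := eqVneq a 0; last first.
  exists a, (inr (inl (a^-1 * b, a^-1 * c))); split=> //=.
  by rewrite cZ d0 mulr0 mulr1 !mulVKf.
have [b0|b0] := eqVneq b 0; last first.
  exists b, (inr (inr (inl (b^-1 * c)))); split=> //=.
  by rewrite cZ d0 a0 mulr0 mulr1 !mulVKf.
exists c, (inr (inr (inr tt))); split; last by rewrite cZ d0 a0 b0 !mulr0 mulr1.
apply: contra_notN nz => /eqP c0.
by rewrite d0 a0 b0 c0; apply: eq_upper3; rewrite !mxE.
Qed.

Lemma card_hyperplanes_through_line0 (P : pred 'M[F]_3) : conic_class P ->
  #|[set H in [set hyperplane a | a : 'M[F]_3 & P a] | line0 \subset H]| =
  #|[set x | P (normal_conic x)]|.
Proof.
move=> [Peq PZ P0 _]; rewrite -(card_imset _ hyperplane_normal_inj).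
apply: eq_card => H; rewrite inE; apply/andP/imsetP.
  case=> /imsetP[a]; rewrite inE => Pa ->; rewrite line0_sub_hyperplane.
  case/andP=> /eqP a01 /eqP a11.
  have ea : eq_upper a (conic (a 1 1) (a 0 0) (a 0 2%:R) (a 1 2%:R)).
    by apply: eq_upper3; rewrite !mxE //= -a11.
  have [|k [x [k0 e]]] := @normalize_conic (a 1 1) (a 0 0) (a 0 2%:R) (a 1 2%:R).
    by move=> e0; apply: (P0 a Pa); apply: eq_upper_trans ea e0.
  exists x; last by rewrite (eq_upper_hyperplane ea) e hyperplaneZ.
  rewrite inE -[normal_conic x]scale1r -(mulVf k0) -scalerA -e.
  by apply: PZ; [rewrite invr_neq0 | apply: Peq Pa].
case=> x; rewrite inE => Px ->; split; first by apply: imset_f; rewrite inE.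
have e d a b c : line0 \subset hyperplane (conic d a b c).
  by rewrite line0_sub_hyperplane !mxE !eqxx.
by case: x {Px} => [[[a b] c]|[[b c]|[c|[]]]]; apply: e.
Qed.

(** [Kact A] permutes the hyperplanes of the class, with inverse [Kact (invmx A)], and respects
    inclusion. *)
Lemma card_hyperplanes_through_Kact (P : pred 'M[F]_3) A (U : {set 'M[F]_3}) :
  conic_class P -> A \in unitmx ->
  #|[set H in [set hyperplane a | a : 'M[F]_3 & P a] | Kact A U \subset H]| =
  #|[set H in [set hyperplane a | a : 'M[F]_3 & P a] | U \subset H]|.
Proof.
move=> [_ _ _ Psub] uA; have uV : invmx A \in unitmx by rewrite unitmx_inv.
have KV := KactK uA; have VK : cancel (Kact (invmx A)) (Kact A).
  by have := KactK uV; rewrite invmxK.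
have Kcl B H : B \in unitmx -> H \in [set hyperplane a | a : 'M[F]_3 & P a] ->
    Kact B H \in [set hyperplane a | a : 'M[F]_3 & P a].
  move=> uB /imsetP[a]; rewrite inE => Pa ->; rewrite Kact_hyperplane //.
  apply: imset_f; rewrite inE.
  by apply: Psub => //; rewrite unitmx_inv.
rewrite -[RHS](card_imset _ (can_inj KV)); apply: eq_card => H.
rewrite inE; apply/andP/imsetP => [[HP UH]|[H' + ->]].
  exists (Kact (invmx A) H); last by rewrite VK.
  by rewrite inE Kcl //= -[U]KV imsetS.
by rewrite inE => /andP[HP UH]; rewrite Kcl // imsetS.
Qed.

End NormalForms.

(** The fibres of [f] on [A] are exactly the two-element sets {x, s x}. *)
Lemma card_imset_involution (T U : finType) (f : T -> U) (s : T -> T) (A : {set T}) :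
  {in A, forall x, [/\ s x \in A, s x != x & f (s x) = f x]} ->
  {in A &, forall x y, f x = f y -> y = x \/ y = s x} ->
  (2 * #|f @: A|)%N = #|A|.
Proof.
move=> sA fA; rewrite -[RHS]sum1_card (partition_big_imset f) /= mulnC -sum_nat_const.
apply: eq_bigr => _ /imsetP[x xA ->]; have [sxA sx fsx] := sA x xA.
have <- : #|[set x; s x]| = 2%N by rewrite cards2 eq_sym sx.
rewrite sum1_card; apply/esym.
apply: eq_card => y; rewrite !inE unfold_in; apply/andP/orP.
  by case=> yA /eqP/esym e; have [->|->] := fA x y xA yA e; [left|right].
by case=> /eqP ->; rewrite ?xA ?sxA ?fsx eqxx.
Qed.

Lemma card_set_sum (S T : finType) (P : pred (S + T)) :
  #|[set x | P x]| = (#|[set x | P (inl x)]| + #|[set x | P (inr x)]|)%N.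
Proof.
by rewrite -!sum1dep_card big_sumType.
Qed.

(** * Line pairs with d = 1, parametrised by (t, u) *)

Section Parametrization.
Variable K : finFieldType.

(** For x = (t, u), the coefficients (a, b, c) of (u X0 + X1 - t X2)(- u X0 + X1 - t^-1 X2); [swap]
    exchanges the two factors. *)
Definition param (x : K * K) : K * K * K :=
  (- x.2 ^+ 2, x.2 * (x.1 - x.1^-1), - (x.1 + x.1^-1)).

Definition swap (x : K * K) : K * K := (x.1^-1, - x.2).

Lemma swapK : involutive swap.
Proof. by case=> t u; rewrite /swap /= invrK opprK. Qed.

Lemma param_swap x : param (swap x) = param x.
Proof. by rewrite /param /= invrK; congr (_, _, _); ring. Qed.

(** The sum t + t^-1 determines t up to inversion, and u^2 determines u up to sign. *)
Lemma param_eq x y : x.1 != 0 -> y.1 != 0 -> param x = param y ->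
  y = x \/ y = swap x.
Proof.
case: x y => [t u] [t' u'] /= t0 t'0.
rewrite /param /= => -[/oppr_inj eu eb /oppr_inj et].
(* The other root t' = t^-1 reduces to t' = t by swapping (t, u). *)
wlog tt' : t u t0 eu eb et / t' = t.
  move=> W; have : (t' - t) * (t' - t^-1) = 0.
    transitivity (t' * ((t' + t'^-1) - (t + t^-1))); first by field; rewrite t0.
    by rewrite et subrr mulr0.
  move/eqP; rewrite mulf_eq0 => /orP[]/eqP/subr0_eq e.
    exact: W.
  have [] := W t^-1 (- u); rewrite ?invr_eq0 // ?invrK ?sqrrN //.
  - by rewrite -eb; ring.
  - by rewrite -et addrC.
  - by rewrite e /swap /= => ->; right.
  - by rewrite /swap /= invrK opprK => ->; left.
rewrite /swap /= tt' in eb *.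
have /eqP : (u' - u) * (u' + u) = 0 by ring: eu.
rewrite mulf_eq0 => /orP[/eqP/subr0_eq ->|]; first by left.
rewrite addr_eq0 => /eqP u'u.
(* With u' = - u: if t = t^-1, then (t, - u) is the swapped pair; otherwise the middle coefficient u
   (t - t^-1) forces u' = u. *)
have [e|ne] := eqVneq (t - t^-1) 0; first by right; rewrite u'u -(subr0_eq e).
by left; rewrite (mulIf ne eb).
Qed.

Definition row3 (x y z : K) : 'rV[K]_3 := \row_i nth 0 [:: x; y; z] i.

Lemma row3_inj x y z x' y' z' : row3 x y z = row3 x' y' z' ->
  [/\ x = x', y = y' & z = z'].
Proof. by move/rowP => e; have := e 0; have := e 1; have := e 2%:R; rewrite !mxE. Qed.

Lemma nonproportional_row3 t u :
  nonproportional (row3 u 1 (- t)) (row3 (- u) 1 (- t^-1)) =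
  (swap (t, u) != (t, u)).
Proof.
rewrite nonproportional_normed ?mxE //; congr (~~ _); apply/eqP/eqP.
  by move=> /row3_inj[uE _ /oppr_inj tE]; rewrite /swap /= -uE -tE.
by rewrite /swap /= => -[-> ->].
Qed.

Lemma param_factor t u : t != 0 ->
  eq_upper (conic 1 (param (t, u)).1.1 (param (t, u)).1.2 (param (t, u)).2)
    (lmul (row3 u 1 (- t)) (row3 (- u) 1 (- t^-1))).
Proof. by move=> t0; apply: eq_upper3; rewrite !mxE /=; field. Qed.

(** The coefficients 1 of X1^2 and X2^2 make the X1- and X2-coordinates of both factors nonzero.
    After scaling the X1-coordinates to 1, the missing X0 X1 term makes the X0-coordinates opposite,
    and the X2^2 term makes the X2-coordinates inverse. *)
Lemma conic_factor a b c k (l m : 'rV[K]_3) :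
  eq_upper (conic 1 a b c) (k *: lmul l m) ->
  exists t u, [/\ t != 0, param (t, u) = (a, b, c),
    l 0 1 != 0 /\ l = l 0 1 *: row3 u 1 (- t)
    & m 0 1 != 0 /\ m = m 0 1 *: row3 (- u) 1 (- t^-1)].
Proof.
move=> e.
have := e 0 0 isT; have := e 0 1 isT; have := e 0 2%:R isT; have := e 1 1 isT.
have := e 1 2%:R isT; have := e 2%:R 2%:R isT; rewrite !mxE /=.
set l0 := l 0 0; set l1 := l 0 1; set l2 := l 0 2%:R.
set m0 := m 0 0; set m1 := m 0 1; set m2 := m 0 2%:R => e22 e12 e11 e02 e01 e00.
have : k * (l1 * m1) != 0 by rewrite -e11 oner_eq0.
have : k * (l2 * m2) != 0 by rewrite -e22 oner_eq0.
rewrite !mulf_eq0 !negb_or => /and3P[k0 l20 m20] /and3P[_ l10 m10].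
have m2E : m2 = m1 * l1 / l2.
  apply: (mulfI l20); apply: (mulfI k0); rewrite -e22 e11; field.
  exact: l20.
have m0E : m0 = - (l0 / l1) * m1.
  apply: (mulfI l10); apply: (mulfI k0); apply: subr0_eq.
  by rewrite [RHS]e01; field; rewrite ?l10 ?l20.
have kE : k = (l1 * m1)^-1.
  by apply: (mulIf (mulf_neq0 l10 m10)); rewrite -e11 mulVf ?mulf_neq0.
exists (- (l2 / l1)), (l0 / l1); split.
- by rewrite oppr_eq0 mulf_neq0 ?invr_eq0.
- rewrite /param /= e00 e02 e12 m2E m0E kE.
  by congr (_, _, _); field; rewrite ?oppr_eq0 ?l10 ?m10 ?l20.
- split=> //; apply/rowP; apply: ord3P; rewrite !mxE /= -/l0 -/l1 -/l2;
    by field; rewrite ?l10 ?l20.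
- split=> //; apply/rowP; apply: ord3P; rewrite !mxE /= -/m0 -/m1 -/m2 ?m0E ?m2E;
    by field; rewrite ?oppr_eq0 ?l10 ?l20.
Qed.

End Parametrization.

Lemma card_pred1C (T : finType) (y : T) : #|[set x | x != y]| = #|T|.-1.
Proof. by rewrite cardsE -(cardC1 y); apply: eq_card. Qed.

(** * Counts over F for d = 1 *)

Section CountF.
Variable F : finFieldType.
Local Notation q := #|F|.

Lemma two_eq0_card : (2%:R == 0 :> F) = ~~ odd q.
Proof.
have [p p_pr pF] := finPcharP F.
have : p.-nat q by have := pprimeChar_pgroup pF; rewrite /pgroup -cardsT.
case/p_natP => n qE; rewrite qE oddX.
have n0 : n != 0%N.
  by apply: contraTneq (finNzRing_gt1 F) => n0; rewrite qE n0.
rewrite (negPf n0) -(dvdn_pcharf pF) dvdn_prime2 //.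
by case: (even_prime p_pr) => [->//|po]; rewrite po; apply: contraTF po => /eqP ->.
Qed.

Definition swap_fixed : {set F * F} := [set x | (x.1 != 0) && (swap x == x)].

(** Fixed points satisfy t^2 = 1 and 2 u = 0: these are (1, 0) and (-1, 0) for q odd, and all (1, u)
    for q even. *)
Lemma card_swap_fixed : #|swap_fixed| = if odd q then 2%N else q.
Proof.
have sqr1 t : t != 0 -> (t^-1 == t) = (t ^+ 2 == 1 :> F).
  by move=> t0; rewrite -(inj_eq (mulfI t0)) mulfV // eq_sym.
have two u : (- u == u) = (2%:R * u == 0 :> F).
  by rewrite eq_sym -subr_eq0 opprK mulr_natl mulr2n.
case: ifPn => [qodd|qeven].
  have two0 : 2%:R != 0 :> F by rewrite two_eq0_card qodd.
  have -> : swap_fixed = [set (1, 0); (-1, 0)].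
    apply/setP => -[t u]; rewrite !inE /swap /= !xpair_eqE.
    have [->|t0] := eqVneq t 0; first by rewrite !(eq_sym 0) oppr_eq0 oner_eq0.
    by rewrite sqr1 // two mulf_eq0 (negPf two0) /= sqrf_eq1 andb_orl.
  rewrite cards2 xpair_eqE eqxx andbT -subr_eq0 opprK.
  by rewrite -[1 + 1]/(2%:R) two0.
have two0 : 2%:R = 0 :> F by apply/eqP; rewrite two_eq0_card qeven.
have -> : swap_fixed = setX [set 1] [set: F].
  apply/setP => -[t u]; rewrite !inE /swap /= !xpair_eqE andbT.
  have [->|t0] := eqVneq t 0; first by rewrite (eq_sym 0) oner_eq0.
  rewrite sqr1 // two two0 mul0r eqxx andbT /=.
  by rewrite sqrf_eq1 -[-1]add0r -[0 in X in _ || X]two0 mulr2n addrK orbb.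
by rewrite cardsX cards1 mul1n cardsT.
Qed.

Definition affine_conics (P : pred 'M[F]_3) : {set F * F * F} :=
  [set v | P (conic 1 v.1.1 v.1.2 v.2)].

(** The equation is a (4 - c^2) = b^2. Each c contributes q solutions: b is free and determines a
    when c^2 differs from 4, otherwise b = 0 and a is free. The [y] in [f] is this free
    coordinate. *)
Lemma card_singular_affine :
  #|~: affine_conics (@nonsingular_conic F)| = (q ^ 2)%N.
Proof.
pose f (x : F * F) :=
  let: (c, y) := x in
  if c ^+ 2 == 4%:R then (y, 0, c) else (y ^+ 2 / (4%:R - c ^+ 2), y, c).
have finj : injective f.
  move=> [c y] [c' y'] /=; case: ifP => h; case: ifP => h' // -[].
  - by move=> -> ->.
  - by move=> _ _ e; rewrite e h' in h.
  - by move=> _ _ e; rewrite e h' in h.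
  - by move=> _ -> ->.
rewrite -[RHS](_ : #|f @: [set: F * F]| = _); last first.
  by rewrite card_imset // cardsT card_prod mulnn.
apply: eq_card => -[[a b] c]; rewrite !inE /nonsingular_conic !mxE /= negbK.
rewrite (_ : _ - _ = a * (4%:R - c ^+ 2) - b ^+ 2); last by ring.
apply/eqP/imsetP => [/subr0_eq e|[[c' y] _ /=]].
  have [h|h] := eqVneq (c ^+ 2) 4%:R.
    exists (c, a); first exact: in_setT.
    rewrite /f ifT ?h //; congr (_, _, _); apply/eqP.
    by rewrite -sqrf_eq0 -e h subrr mulr0.
  exists (c, b); first exact: in_setT.
  rewrite /f ifN // -e mulfK //.
  by rewrite subr_eq0 eq_sym.
case: ifPn => [/eqP h|h] -[-> -> ->]; first by rewrite h; ring.
by rewrite divfK ?subrr // subr_eq0 eq_sym.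
Qed.

Lemma card_nonsingular_affine :
  #|affine_conics (@nonsingular_conic F)| = (q ^ 3 - q ^ 2)%N.
Proof.
have <- : #|{: F * F * F}| = (q ^ 3)%N by rewrite !card_prod !expnS expn0 muln1 mulnA.
by rewrite -card_singular_affine -(cardsC (affine_conics (@nonsingular_conic F))) addnK.
Qed.

(** When the two factors coincide, so do their normalised forms, which means that (t, u) is fixed by
    [swap]. *)
Lemma double_line_affine :
  affine_conics (@double_line F) = @param F @: swap_fixed.
Proof.
apply/setP => -[[a b] c]; rewrite inE /=; apply/double_lineP/imsetP.
  case=> k [l [_ _ /conic_factor[t [u [t0 <- [l1 lE] [_ lE']]]]]].
  exists (t, u) => //; rewrite inE t0 /swap xpair_eqE /=.
  have [uE _ /oppr_inj e] := row3_inj (scalerI l1 (etrans (esym lE) lE')).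
  by rewrite -e -uE !eqxx.
case=> -[t u]; rewrite inE /swap xpair_eqE /= => /and3P[t0 /eqP tV /eqP uN] pE.
exists 1, (row3 u 1 (- t)); split; first exact: oner_neq0.
  by apply/eqP => /rowP/(_ 1)/eqP; rewrite !mxE oner_eq0.
have := param_factor u t0; rewrite -pE /= tV uN.
by rewrite scale1r.
Qed.

Lemma real_line_pair_affine :
  affine_conics (@real_line_pair F) =
  @param F @: [set x | (x.1 != 0) && (swap x != x)].
Proof.
apply/setP => -[[a b] c]; rewrite inE /=; apply/real_line_pairP/imsetP.
  case=> l [m []]; rewrite -[lmul l m]scale1r.
  move=> + /conic_factor[t [u [t0 <- [l1 lE] [m1 mE]]]].
  rewrite lE mE nonproportionalZ ?mxE // ?mulr1 // nonproportional_row3 => sw.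
  by exists (t, u); rewrite // inE t0.
case=> -[t u]; rewrite inE /= => /andP[t0 sw] [-> -> ->].
exists (row3 u 1 (- t)), (row3 (- u) 1 (- t^-1)); rewrite nonproportional_row3.
by split=> //; apply: param_factor.
Qed.

Lemma card_double_line_affine :
  #|affine_conics (@double_line F)| = #|swap_fixed|.
Proof.
rewrite double_line_affine card_in_imset // => x y.
rewrite !inE => /andP[x0 /eqP sx] /andP[y0 _] /(param_eq x0 y0).
by rewrite sx => -[].
Qed.

Lemma card_param_swap (K : finFieldType) (A : {set K * K}) :
  {in A, forall x, [/\ x.1 != 0, swap x != x & swap x \in A]} ->
  (2 * #|@param K @: A|)%N = #|A|.
Proof.
move=> hA; apply: (@card_imset_involution _ _ _ (@swap K));
  [move=> x /hA[] | move=> x y /hA[x0 _ _] /hA[y0 _ _]].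
  by rewrite param_swap.
exact: param_eq.
Qed.

Lemma card_real_line_pair_affine :
  (2 * #|affine_conics (@real_line_pair F)| + #|swap_fixed|)%N
  = (q * q.-1)%N.
Proof.
rewrite real_line_pair_affine card_param_swap; last first.
  move=> x; rewrite !inE => /andP[x0 sx].
  by rewrite sx swapK [x == _]eq_sym sx /swap /= invr_eq0 x0.
have -> : (q * q.-1)%N = #|setX [set t : F | t != 0] [set: F]|.
  by rewrite cardsX cardsT card_pred1C mulnC.
rewrite addnC -[RHS](cardsID swap_fixed); congr (_ + _)%N; apply: eq_card => x;
  by rewrite !inE andbT; case: (x.1 != 0); case: (swap x == x).
Qed.

End CountF.

(** * Imaginary line pairs for d = 1, counted over E *)

Section CountE.
Variables (F E : finFieldType) (iota : {rmorphism F -> E}).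
Local Notation q := #|F|.
Hypothesis card_E : #|E| = (q ^ 2)%N.

Let q_gt1 : (1 < q)%N. Proof. exact: finNzRing_gt1. Qed.

Lemma exprN_card (x : E) : (- x) ^+ q = - x ^+ q.
Proof.
apply/eqP; rewrite -addr_eq0 -(exprD_card iota) addNr expr0n gtn_eqF //.
exact: ltnW.
Qed.

(** The condition is t^(q+1) = 1, and q + 1 divides the order q^2 - 1 of the cyclic group of E, so a
    primitive (q+1)-th root of unity exists. *)
Lemma card_norm1 : #|[set t : E | (t != 0) && (t ^+ q == t^-1)]| = q.+1.
Proof.
have n0 : (0 < #|E|.-1)%N by have := finNzRing_gt1 E; case: #|E| => [|[]].
have [|||z _ zP] := hasP (@has_prim_root E #|E|.-1 (enum [set t : E | t != 0]) n0 _ _ _).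
- apply/allP => t; rewrite mem_enum inE => t0; apply/unity_rootP.
  apply: (mulIf t0); rewrite mul1r -exprSr prednK ?expf_card //.
  by rewrite ltnW ?finNzRing_gt1.
- exact: enum_uniq.
- by rewrite -cardE card_pred1C.
have nE : #|E|.-1 = (q.-1 * q.+1)%N.
  by rewrite card_E; move: q_gt1; case: #|F| => // n _; nia.
have /(dvdn_prim_root zP) : (q.+1 %| #|E|.-1)%N by rewrite nE dvdn_mull.
set w := z ^+ _ => wP.
have wI : injective (fun i : 'I_q.+1 => w ^+ i).
  move=> i j /eqP; rewrite (eq_prim_root_expr wP) !modn_small // => /eqP.
  exact: val_inj.
rewrite -[RHS]card_ord -(card_imset _ wI); apply: eq_card => t.
have tE : (t != 0) && (t ^+ q == t^-1) = (t ^+ q.+1 == 1).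
  have [->|t0] := eqVneq t 0; first by rewrite exprS mul0r [RHS]eq_sym oner_eq0.
  by rewrite exprSr -(inj_eq (mulIf t0)) mulVf.
rewrite inE tE; apply/eqP/imsetP => [/(prim_rootP wP)[i ->]|[i _ ->]].
  by exists i.
by rewrite exprAC (prim_expr_order wP) expr1n.
Qed.

(** If e is not in F, then d = e^q - e is a nonzero solution, and the solutions are exactly its
    multiples by F. *)
Lemma card_trace0 : #|[set u : E | u ^+ q == - u]| = q.
Proof.
have [e eN] : exists e : E, e ^+ q != e.
  apply/existsP; rewrite -negb_forall; apply/forallP => fix_all.
  have : (#|[set iota y | y in [set: F]]| < #|[set: E]|)%N.
    rewrite card_imset; last exact: fmorph_inj.
    by rewrite !cardsT card_E -[X in (X < _)%N]expn1 ltn_exp2l.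
  rewrite ltnNge subset_leq_card //; apply/subsetP => x _.
  by have [y ->] := card_fixed_Frobenius iota (eqP (fix_all x)); apply: imset_f.
pose d := e ^+ q - e.
have d0 : d != 0 by rewrite subr_eq0.
have dq : d ^+ q = - d.
  by rewrite (exprD_card iota) exprN_card -exprM mulnn -card_E expf_card opprB.
rewrite -[RHS](card_imset _ (_ : injective (fun x => iota x * d))); last first.
  by move=> x y /(mulIf d0)/fmorph_inj.
apply: eq_card => u; rewrite inE; apply/eqP/imsetP => [uq|[x _ ->]].
  have [|x xE] := card_fixed_Frobenius iota (x := u / d).
    by rewrite exprMn exprVn uq dq invrN mulrNN.
  by exists x; rewrite // -xE divfK.
by rewrite exprMn -rmorphXn /= expf_card dq mulrN.
Qed.

Definition norm_trace_set : {set E * E} :=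
  [set x | [&& x.1 != 0, x.1 ^+ q == x.1^-1 & x.2 ^+ q == - x.2]].

Lemma card_norm_trace_set : #|norm_trace_set| = (q.+1 * q)%N.
Proof.
rewrite -card_norm1 -[X in (_ * X)%N]card_trace0 -cardsX; apply: eq_card => x.
by rewrite !inE andbA.
Qed.

Definition map3 (v : F * F * F) : E * E * E := (iota v.1.1, iota v.1.2, iota v.2).

Lemma map3_inj : injective map3.
Proof.
by move=> [[a b] c] [[a' b'] c'] [/fmorph_inj -> /fmorph_inj -> /fmorph_inj ->].
Qed.

(** Conjugacy of the normalised factors says precisely that t^q = t^-1 and u^q = - u. The images
    under [map3] are compared because the parameters live in E. *)
Lemma imaginary_line_pair_affine :
  map3 @: affine_conics (imaginary_line_pair iota) =
  @param E @: [set x in norm_trace_set | swap x != x].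
Proof.
have mapc a b c : map_mx iota (conic 1 a b c) = conic 1 (iota a) (iota b) (iota c).
  by apply/matrixP; apply: ord3P; apply: ord3P; rewrite !mxE /= ?rmorph1 ?rmorph0.
have crow k (u t : E) :
    conj_row F (k *: row3 u 1 (- t)) = k ^+ q *: row3 (u ^+ q) 1 (- t ^+ q).
  apply/rowP; apply: ord3P; rewrite !mxE /= exprMn ?expr1n //.
  by rewrite exprN_card.
apply/setP => v; apply/imsetP/imsetP.
  case=> -[[a b] c]; rewrite inE => /imaginary_line_pairP[k [l [k0 lm]]] /=.
  rewrite mapc => /conic_factor[t [u [t0 pE [l1 lE] [m1 mE]]]] ->.
  exists (t, u); last by rewrite pE.
  have [uq _ tq] : [/\ u ^+ q = - u, 1 = 1 :> E & - t ^+ q = - t^-1].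
    apply: row3_inj; apply: (scalerI m1); rewrite -mE lE crow !mxE /= mulr1.
    by [].
  rewrite !inE t0 uq (oppr_inj tq) !eqxx /= -nonproportional_row3.
  move: lm; rewrite lE crow uq (oppr_inj tq) nonproportionalZ //.
  by rewrite expf_neq0.
case=> -[t u]; rewrite !inE /= => /andP[/and3P[t0 /eqP tq /eqP uq] sw] ->.
(* Conjugation acts on these (t, u) as [swap], which fixes all three coefficients, so they come from
   F. *)
have [a aE] : exists a, - u ^+ 2 = iota a.
  by apply: card_fixed_Frobenius; rewrite exprN_card exprAC uq sqrrN.
have [b bE] : exists b, u * (t - t^-1) = iota b.
  apply: card_fixed_Frobenius; rewrite exprMn (exprD_card iota) exprN_card exprVn.
  by rewrite uq tq invrK; ring.
have [c cE] : exists c, - (t + t^-1) = iota c.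
  apply: card_fixed_Frobenius; rewrite exprN_card (exprD_card iota) exprVn.
  by rewrite tq invrK addrC.
exists (a, b, c); last by rewrite /param /map3 /= aE bE cE.
rewrite inE; apply/imaginary_line_pairP; exists 1, (row3 u 1 (- t)).
rewrite -[row3 u _ _]scale1r crow expr1n !scale1r uq tq nonproportional_row3; split=> //.
  exact: oner_neq0.
by rewrite mapc -aE -bE -cE; apply: param_factor.
Qed.

(** Here t^q = t^-1 = t and u^q = - u = u, so the fixed points lie in F; conversely those over F
    satisfy the norm and trace conditions. *)
Lemma card_swap_fixed_norm_trace :
  #|[set x in norm_trace_set | swap x == x]| = #|swap_fixed F|.
Proof.
pose f (x : F * F) : E * E := (iota x.1, iota x.2).
have fI : injective f by move=> [a b] [c d] [/fmorph_inj -> /fmorph_inj ->].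
rewrite -(card_imset _ fI); apply: eq_card => -[t u]; rewrite !inE /swap /= xpair_eqE.
apply/idP/imsetP.
  case/andP => /and3P[t0 /eqP tq /eqP uq] /andP[/eqP tV /eqP uN].
  have [x xE] : exists x, t = iota x by apply: card_fixed_Frobenius; rewrite tq.
  have [y yE] : exists y, u = iota y by apply: card_fixed_Frobenius; rewrite uq.
  exists (x, y); last by rewrite /f /= xE yE.
  rewrite inE /swap xpair_eqE /=; move: t0 tV uN.
  rewrite xE yE fmorph_eq0 -fmorphV -rmorphN => -> /fmorph_inj -> /fmorph_inj ->.
  by rewrite !eqxx.
case=> -[x y]; rewrite inE /swap xpair_eqE /= => /and3P[x0 /eqP xV /eqP yN] [-> ->].
rewrite fmorph_eq0 x0 -!rmorphXn /= !expf_card -fmorphV -rmorphN xV yN !eqxx.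
by [].
Qed.

Lemma card_imaginary_line_pair_affine :
  (2 * #|affine_conics (imaginary_line_pair iota)| + #|swap_fixed F|)%N = (q.+1 * q)%N.
Proof.
rewrite -(card_imset _ map3_inj) imaginary_line_pair_affine card_param_swap; last first.
  case=> t u; rewrite !inE => /andP[/and3P[/= t0 /eqP tq /eqP uq] sx].
  rewrite sx swapK [_ == swap _]eq_sym sx /= invr_eq0 t0 exprVn tq exprN_card uq.
  by rewrite invrK !eqxx.
rewrite -card_swap_fixed_norm_trace -card_norm_trace_set addnC.
rewrite -[RHS](cardsID [set x | swap x == x]); congr (_ + _)%N; apply: eq_card => x.
  by rewrite !inE.
by rewrite !inE andbC.
Qed.

End CountE.

(** * The conics with d = 0 *)

Section AtInfinity.
Variable F : finFieldType.
Local Notation q := #|F|.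
Implicit Types a b c : F.

Lemma conic0_square (K : finFieldType) (a b c k : K) (l : 'rV[K]_3) :
  eq_upper (conic 0 a b c) (k *: lmul l l) -> k != 0 -> b = 0 /\ c = 0.
Proof.
move=> e k0; have := e 1 1 isT; have := e 2%:R 2%:R isT.
have := e 0 2%:R isT; have := e 1 2%:R isT; rewrite !mxE /= => -> ->.
move/esym/eqP; rewrite !mulf_eq0 (negPf k0) /= orbb => /eqP l2.
move/esym/eqP; rewrite !mulf_eq0 (negPf k0) /= orbb => /eqP l1.
by rewrite l1 l2; split; ring.
Qed.

Lemma double_line0 a b c : double_line (conic 0 a b c) =
  [&& a != 0, b == 0 & c == 0].
Proof.
apply/idP/and3P => [/[dup] d /double_lineP[k [l [k0 _ /conic0_square e]]]|].
  have [b0 c0] := e k0; rewrite b0 c0 !eqxx; split=> //.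
  have [_ _ nz _] := double_line_class F; apply: contra_notN (nz _ d) => /eqP a0.
  by rewrite a0 b0 c0; apply: eq_upper3; rewrite !mxE.
case=> a0 /eqP-> /eqP->; apply/double_lineP; exists a, (row3 1 0 0); split=> //.
  by apply/eqP => /rowP/(_ 0)/eqP; rewrite !mxE oner_eq0.
by apply: eq_upper3; rewrite !mxE /=; ring.
Qed.

(** The X0^2 coefficient 1 makes l_0 and m_0 nonzero; the vanishing X1^2 and X0 X1 terms then give
    l_1 = m_1 = 0. What remains is X0 (X0 + b X2) up to scalars of the factors. *)
Lemma real_line_pair0 b c : real_line_pair (conic 0 1 b c) = (c == 0) && (b != 0).
Proof.
apply/real_line_pairP/andP => [[l [m [lm e]]]|[/eqP-> b0]].
  have := e 0 0 isT; have := e 0 1 isT; have := e 0 2%:R isT; have := e 1 1 isT.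
  have := e 1 2%:R isT; have := e 2%:R 2%:R isT; rewrite !mxE /=.
  move: lm; rewrite nonproportionalE.
  set l0 := l 0 0; set l1 := l 0 1; set l2 := l 0 2%:R.
  set m0 := m 0 0; set m1 := m 0 1; set m2 := m 0 2%:R => lm e22 e12 e11 e02 e01 e00.
  have /andP[l00 m00] : (l0 != 0) && (m0 != 0).
    by rewrite -negb_or -mulf_eq0 -e00 oner_eq0.
  have [l10 m10] : l1 = 0 /\ m1 = 0.
    move/esym/eqP: e11; rewrite mulf_eq0 => /orP[]/eqP e1; split=> //;
      move: e01; rewrite e1 !(mulr0, mul0r, addr0, add0r) => /esym/eqP;
      by rewrite mulf_eq0 ?(negPf l00) ?(negPf m00) ?orbF /= => /eqP.
  rewrite e12 l10 m10 mul0r mulr0 addr0 eqxx; split=> //.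
  move: lm; rewrite l10 m10 !(mulr0, mul0r) eqxx /= orbF e02.
  move/esym/eqP: e22; rewrite mulf_eq0 => /orP[]/eqP ->;
    by rewrite !(mulr0, mul0r, addr0, add0r) // eq_sym.
exists (row3 1 0 0), (row3 1 0 b); split.
  by rewrite nonproportionalE !mxE /= !(mul1r, mul0r) b0 orbT.
by apply: eq_upper3; rewrite !mxE /=; ring.
Qed.

(** The form is X2 (b X0 + c X1). *)
Lemma real_line_pair00 b c : (b != 0) || (c != 0) -> real_line_pair (conic 0 0 b c).
Proof.
move=> bc; apply/real_line_pairP; exists (row3 0 0 1), (row3 b c 0); split.
  by rewrite nonproportionalE !mxE /= !(mul1r, mul0r) eqxx (eq_sym 0 b) (eq_sym 0 c) bc.
by apply: eq_upper3; rewrite !mxE /=; ring.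
Qed.

Lemma nonsingular_conic0 a b c :
  nonsingular_conic (conic 0 a b c) = (a != 0) && (c != 0).
Proof.
rewrite /nonsingular_conic !mxE /= (_ : _ - _ = - (a * c ^+ 2)); last by ring.
by rewrite oppr_eq0 mulf_eq0 sqrf_eq0 negb_or.
Qed.

(** The X1^2 and X2^2 coefficients are k times the norms l_1^(q+1) and l_2^(q+1). Their vanishing
    leaves only l_0, so l is proportional to its conjugate. *)
Lemma imaginary_line_pair0 (E : finFieldType) (iota : {rmorphism F -> E}) a b c :
  imaginary_line_pair iota (conic 0 a b c) = false.
Proof.
case: imaginary_line_pairP => // -[k [l [k0 lm e]]].
have := e 1 1 isT; have := e 2%:R 2%:R isT; rewrite !mxE /= rmorph0.
have zero (x : E) : 0 = k * (x * x ^+ q) -> x = 0.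
  move/esym/eqP; rewrite -exprS mulf_eq0 expf_eq0 (negPf k0) /=.
  by move/eqP.
move=> /zero l2 /zero l1; move: lm; rewrite nonproportionalE !mxE l1 l2.
have q0 : (0 : E) ^+ q = 0 by rewrite expr0n gtn_eqF // ltnW // finNzRing_gt1.
by rewrite q0 !(mulr0, mul0r) eqxx.
Qed.

Lemma card_normal_form (P : pred 'M[F]_3) :
  #|[set x | P (normal_conic x)]| =
  (#|affine_conics P| + (#|[set v : F * F | P (conic 0%R 1%R v.1 v.2)]|
    + (#|[set c : F | P (conic 0%R 0%R 1%R c)]| + P (conic 0%R 0%R 0%R 1%R))))%N.
Proof.
rewrite !card_set_sum /=; congr (_ + (_ + (_ + _)))%N.
- by apply: eq_card => -[[a b] c]; rewrite !inE.
- by apply: eq_card => -[b c]; rewrite !inE.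
rewrite -sum1dep_card big_mkcond big_const card_unit /= addn0.
by case: (P _).
Qed.

End AtInfinity.

(* The halves below are exact, and the subtractions are not truncated, since  *)
(* q >= 2 and the division by 2 is applied only to even numbers.              *)
Theorem lemma4p11 (q : nat) (F E : finFieldType) (iota : {rmorphism F -> E})
    (hF : #|F| = q) (hE : #|E| = (q ^ 2)%N)
    (L : {set 'M[F]_3}) (hL : L \in o_13_1 F) :
  (odd q ->
     OD4 iota L = [:: 3; (q ^ 2 + 3 * q - 2) %/ 2;
                      (q ^ 2 + q - 2) %/ 2; q ^ 3 - q]%N) /\
  (~~ odd q ->
     OD4 iota L = [:: q + 1; q ^ 2 %/ 2 + q; q ^ 2 %/ 2; q ^ 3 - q]%N).
Proof.
subst q; set q := #|F| in hE *.
have [A uA ->] : exists2 A : 'M[F]_3, A \in unitmx & L = Kact A (line0 F).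
  by case/imsetP: hL => A; rewrite inE; exists A.
have count P : conic_class P ->
    #|[set H in [set hyperplane a | a : 'M[F]_3 & P a] | Kact A (line0 F) \subset H]| =
    (#|affine_conics P| + (#|[set v : F * F | P (conic 0%R 1%R v.1 v.2)]|
    + (#|[set c : F | P (conic 0%R 0%R 1%R c)]| + P (conic 0%R 0%R 0%R 1%R))))%N.
  move=> cP; rewrite card_hyperplanes_through_Kact //.
  by rewrite card_hyperplanes_through_line0 // card_normal_form.
have q1 : (1 < q)%N := finNzRing_gt1 F.
have empty (T : finType) (P : pred T) : P =1 xpred0 -> #|[set x | P x]| = 0%N.
  by move=> P0; apply/eqP; rewrite cards_eq0; apply/eqP/setP => x; rewrite !inE P0.
have n1 : #|[set c : F | c != 0]| = q.-1 by rewrite card_pred1C.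
have -> : OD4 iota (Kact A (line0 F)) =
    [:: #|swap_fixed F| + 1; #|affine_conics (@real_line_pair F)| + 2 * q;
        #|affine_conics (imaginary_line_pair iota)|; q ^ 3 - q]%N.
  rewrite /OD4 /=; congr [:: _; _; _; _].
  - rewrite (count _ (double_line_class F)) card_double_line_affine.
    rewrite double_line0 eqxx /= !addn0 [X in (_ + (_ + X))%N]empty; last first.
      by move=> c; rewrite double_line0 eqxx.
    (* The only double line with d = 0 is X0^2, at (b, c) = (0, 0). *)
    rewrite addn0 -[1%N](cards1 ((0, 0) : F * F)); congr (_ + _)%N.
    by apply: eq_card => -[b c]; rewrite !inE double_line0 oner_eq0.
  (* For d = 0 there are q - 1 real pairs with a = 1 and q + 1 with a = 0, hence 2q. *)
  - rewrite (count _ (real_line_pair_class F)); congr (_ + _)%N.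
    rewrite real_line_pair00 ?oner_eq0 ?orbT //.
    rewrite (_ : [set c | _] = [set: F]); last first.
      by apply/setP => c; rewrite !inE real_line_pair00 // oner_eq0.
    rewrite (_ : [set v | _] = setX [set c : F | c != 0] [set 0]); last first.
      by apply/setP => -[b c]; rewrite !inE real_line_pair0 andbC.
    rewrite cardsX cards1 cardsT n1 -/q; lia.
  - rewrite (count _ (imaginary_line_pair_class iota)) imaginary_line_pair0.
    rewrite [X in (_ + (X + _))%N]empty ?[X in (_ + (_ + (X + _)))%N]empty ?addn0 // => x;
      by rewrite imaginary_line_pair0.
  (* For d = 0 the nonsingular conics have a = 1 and c nonzero, which adds q(q - 1). *)
  - rewrite (count _ (nonsingular_conic_class F)) card_nonsingular_affine.
    rewrite nonsingular_conic0 eqxx /= addn0 [X in (_ + (_ + X))%N]empty; last first.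
      by move=> c; rewrite nonsingular_conic0 eqxx.
    rewrite (_ : [set v | _] = setX [set: F] [set c : F | c != 0]); last first.
      by apply/setP => -[b c]; rewrite !inE nonsingular_conic0 oner_eq0.
    rewrite cardsX cardsT n1 -/q addn0; nia.
have := card_real_line_pair_affine F; have := card_imaginary_line_pair_affine iota hE.
rewrite card_swap_fixed -/q.
set r := #|_|; set i := #|_|; move=> ri ii.
split=> [qo|/negPf qe].
  (* The two equations present each numerator as twice a natural number, which makes the divisions
     exact. *)
  rewrite qo in ri ii *; congr [:: _; _; _; _]; nia.
rewrite qe in ri ii *; congr [:: _; _; _; _]; nia.
Qed.
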